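(* (a) Let $d=1$ and let $\mu$ be a translation invariant product probability measure on $\mathbb{N}^{\mathbb{Z}}$ with $\mathbb{E}_\mu(e^{t\eta(0)})<\infty$ for all $t\in\mathbb{R}$ and density $\rho=\mathbb{E}_\mu(\eta(0))<1$. Then there is a constant $c_1>0$ such that for all $n$, $\mathbb{P}_\mu(|\mathcal{T}_\infty(0)|\ge n)\le e^{-c_1n}$. (b) Let $d>1$ and let $(\mu_\rho)_{0<\rho<1}$ be a family of translation invariant product probability measures on $\mathbb{N}^{\mathbb{Z}^d}$ satisfying: (i) $G_\rho(t)=\mathbb{E}_{\mu_\rho}(e^{t\eta(0)})<\infty$ for all $t\in\mathbb{R}$; (ii) $\mathbb{E}_{\mu_\rho}(\eta(0))=\rho$; (iii) whenever $a_\rho\ge0$ with $a_\rho\to\infty$ as $\rho\to0$, also $\sup\{x:G_\rho(x)\le a_\rho\}\to\infty$ as $\rho\to0$. Then for all $\rho$ sufficiently small there is a constant $c_d=c_d(d,\rho)>0$ such that for all $n$, $\mathbb{P}_{\mu_\rho}(|\mathcal{T}_\infty(0)|\ge n)\le e^{-c_dn}$.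
   Context: Sandpile model on $\mathbb{Z}^d$: $\eta\in\mathbb{N}^{\mathbb{Z}^d}$, site $x$ unstable if $\eta(x)\ge 2d$; toppling $x$ removes $2d$ grains from $x$ and adds one to each of its $2d$ nearest neighbors. A configuration $\eta$ is stabilizable if there is a legal toppling procedure (topplings of unstable sites only, occurring at times in $[0,\infty)$, finitely many per site in bounded time, no infinite backward chain of topplings at neighboring sites at decreasing times) in which every site topples finitely often and the final configuration $\eta_\infty$ is stable ($\eta_\infty(x)\le 2d-1$ for all $x$); then the number of topplings at each site, and $\eta_\infty$, do not depend on the chosen stabilizing procedure. (It is known that translation invariant measures with density $<d$ are stabilizable, so the measures in the theorem are stabilizable a.s.) For stabilizable $\eta$, $\mathcal{T}_\infty$ is the set of sites that topple at least once during stabilization, and $\mathcal{T}_\infty(0)$ is the connected component (for nearest-neighbor adjacency) of $\mathcal{T}_\infty$ containing the origin (empty if the origin does not topple); $|\cdot|$ denotes cardinality. *)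

(* Defs.v *)
From HB Require Import structures.
From mathcomp Require Import all_boot all_order all_algebra.
From mathcomp Require Import all_classical all_reals all_analysis.
Set Implicit Arguments. Unset Strict Implicit. Unset Printing Implicit Defensive.
Import Order.TTheory GRing.Theory Num.Theory.
Import numFieldNormedType.Exports.
Local Open Scope classical_set_scope.
Local Open Scope ring_scope.

Definition site (d : nat) := 'rV[int]_d.

Definition unit_vec (d : nat) (i : 'I_d) : site d := delta_mx 0 i.

Definition adj (d : nat) (x y : site d) : Prop :=
  exists i : 'I_d, y = x + unit_vec i \/ y = x - unit_vec i.

Definition nbr_sum (d : nat) (f : site d -> nat) (x : site d) : nat :=
  \sum_(i < d) (f (x + unit_vec i)%R + f (x - unit_vec i)%R)%N.

(* A toppling procedure in which every site topples finitely often is given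
   by the finite list of toppling times of each site (strictly increasing,
   all in [0, oo)); one toppling per listed time. *)
Definition procedure (R : realType) (d : nat) := site d -> seq R.

Definition ntop_before (R : realType) (d : nat) (tau : procedure R d)
    (x : site d) (t : R) : nat :=
  count (fun s => s < t) (tau x).

Definition legal_stabilizing (R : realType) (d : nat) (eta : site d -> nat)
    (tau : procedure R d) : Prop :=
  (forall x, all (fun s => 0 <= s) (tau x) /\ sorted <%R (tau x)) /\
  (* legality: at a toppling time t of x, eta_{t-}(x) >= 2d, where
     eta_{t-}(x) = eta(x) - 2d N_{t-}(x) + sum_{y~x} N_{t-}(y) *)
  (forall x t, t \in tau x ->
     (2 * d + 2 * d * ntop_before tau x t
        <= eta x + nbr_sum (fun y => ntop_before tau y t) x)%N) /\
  (~ exists (xs : nat -> site d) (ts : nat -> R),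
       forall k, ts k \in tau (xs k) /\ adj (xs k) (xs k.+1) /\ ts k.+1 < ts k) /\
  (* final configuration eta_oo = eta - 2d N_oo + sum_{y~x} N_oo(y) is stable:
     eta_oo(x) <= 2d - 1 *)
  (forall x, (eta x + nbr_sum (fun y => size (tau y)) x
                < 2 * d + 2 * d * size (tau x))%N).

Definition stabilizable (R : realType) (d : nat) (eta : site d -> nat) : Prop :=
  exists tau : procedure R d, legal_stabilizing eta tau.

(* T_oo : sites that topple at least once during stabilization (the number of
   topplings does not depend on the stabilizing procedure); empty if eta is
   not stabilizable. *)
Definition T_infty (R : realType) (d : nat) (eta : site d -> nat) : set (site d) :=
  [set x | exists tau : procedure R d, legal_stabilizing eta tau /\ (0 < size (tau x))%N].

(* connected component of A containing o (empty if o \notin A) *)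
Definition component (d : nat) (A : set (site d)) (o : site d) : set (site d) :=
  [set y | exists (k : nat) (p : nat -> site d),
     p 0%N = o /\ p k = y /\ (forall j, (j <= k)%N -> A (p j)) /\
     (forall j, (j < k)%N -> adj (p j) (p j.+1))].

Definition card_ge (d : nat) (A : set (site d)) (n : nat) : Prop :=
  exists s : seq (site d), uniq s /\ size s = n /\ (forall x, x \in s -> A x).

(* Under P, the random field eta : Omega -> N^{Z^d} has i.i.d. coordinates,
   i.e. its law is a translation invariant product measure. *)
Definition iid_field (R : realType) (d0 : measure_display) (Omega : measurableType d0)
    (P : probability Omega R) (d : nat) (eta : Omega -> site d -> nat) : Prop :=
  (forall x k, measurable [set w | eta w x = k]) /\
  (forall x k, P [set w | eta w x = k] = P [set w | eta w 0 = k]) /\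
  (forall (s : seq (site d)) (k : site d -> nat), uniq s ->
     P (\bigcap_(x in [set` s]) [set w | eta w x = k x]) =
     (\big[*%E/1%E]_(x <- s) P [set w | eta w x = k x])%E).

Definition mgf (R : realType) (d0 : measure_display) (Omega : measurableType d0)
    (P : probability Omega R) (d : nat) (eta : Omega -> site d -> nat) (t : R) : \bar R :=
  (\int[P]_w (expR (t * (eta w 0)%:R))%:E)%E.

Definition density (R : realType) (d0 : measure_display) (Omega : measurableType d0)
    (P : probability Omega R) (d : nat) (eta : Omega -> site d -> nat) : \bar R :=
  (\int[P]_w ((eta w 0)%:R)%:E)%E.

Definition prob_le (R : realType) (d0 : measure_display) (Omega : measurableType d0)
    (P : probability Omega R) (A : set Omega) (b : R) : Prop :=
  exists B, measurable B /\ A `<=` B /\ (P B <= b%:E)%E.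

Definition big_cluster (R : realType) (Omega : Type) (d : nat)
    (eta : Omega -> site d -> nat) (n : nat) : set Omega :=
  [set w | card_ge (component (T_infty R (eta w)) 0) n].

(* Main.v *)
Require Import Defs.
From HB Require Import structures.
From mathcomp Require Import all_boot all_order all_algebra.
From mathcomp Require Import all_classical all_reals all_analysis.
From mathcomp Require Import measurable_realfun zify ring lra.
Import Order.TTheory GRing.Theory Num.Theory.
Import numFieldNormedType.Exports.
Local Open Scope classical_set_scope.
Local Open Scope ring_scope.

(** If the toppling cluster of the origin has at least [n] sites, then finitely
many topplings already witness it, and in the connected component [A] of the
sites involved every site topples. Just before its last toppling a site [x] is
unstable, and it has not yet received the grains of those neighbours whose last
toppling comes later. Summing over [A], the outflow through the boundary plus
one grain per internal edge shows that [A] initially carried at least [d |A|]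
grains.

By Chernoff, a set of size [m] is this heavy with probability at most
[(e^(-td) G(t))^m], and one sums over the connected sets containing the origin.
For [d = 1] these are intervals, and [e^(-t) G(t) < 1] for small [t > 0] because
the density is below [1]. For [d > 1] there are at most [(2d)^(2m-2)] of them
(they are traced by closed walks), and condition (iii) with [a_rho = 1/rho]
bounds [G_rho(2t)] by [1/rho], hence [G_rho(t)] by [2], at any fixed [t] once
[rho] is small.

For [d = 1] and small [n], the bound must be strictly below [1]. Conditioning on
[eta = 0] on a long interval around the origin only lowers the chance of a heavy
interval, and leaves only the long ones, so with positive probability the origin
does not topple. *)

(** * Lattice animals and the mass of a toppling cluster *)
Section Animals.
Variable d : nat.
Implicit Types (A U : seq (site d)) (x y : site d).

Definition nbrs x : seq (site d) :=
  [seq x + unit_vec i | i <- enum 'I_d] ++ [seq x - unit_vec i | i <- enum 'I_d].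

Lemma adj_nbrs x y : adj x y <-> y \in nbrs x.
Proof.
rewrite mem_cat; split.
  by case=> i [->|->]; apply/orP; [left|right]; apply: map_f; rewrite mem_enum.
by case/orP => /mapP[i _ ->]; exists i; [left|right].
Qed.

(** Lattice animals containing the origin, listed with the newest site in front. Recording the order
    of growth allows induction on the sites, which later yields both the tracing walks and the
    interval shape when [d = 1]. *)
Inductive animal : seq (site d) -> Prop :=
| animal1 : animal [:: 0]
| animal_cons A x y : animal A -> x \in A -> adj x y -> y \notin A ->
    animal (y :: A).

Lemma animal_uniq A : animal A -> uniq A.
Proof. by elim=> // {}A x y _ uA _ _ yA; rewrite /= yA. Qed.

(** Greedy growth: as long as some neighbour of [A] in [U] is missing, add it. In the induction, [k]
    bounds the number of sites still available, so growth stops, at the component of [0] in [U]. *)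
Lemma animal_closed_in U : 0 \in U ->
  exists2 A, animal A /\ {subset A <= U} &
    forall x y, x \in A -> adj x y -> y \in U -> y \in A.
Proof.
move=> U0.
suff H k A : animal A -> {subset A <= U} -> (size (undup U) <= size A + k)%N ->
    exists2 A, animal A /\ {subset A <= U} &
    forall x y, x \in A -> adj x y -> y \in U -> y \in A.
  apply: (H (size (undup U)) [:: 0]) => //; first exact: animal1.
    by move=> x; rewrite inE => /eqP->.
elim: k A => [|k IH] A aA AU sA.
  exists A => // x y xA xy yU.
  have AU' : {subset A <= undup U} by move=> z /AU; rewrite mem_undup.
  rewrite addn0 in sA.
  by have [_ ->] := uniq_min_size (animal_uniq _ aA) AU' sA; rewrite mem_undup.
have [[x [y [xA xy yU yA]]]|H] :=
  pselect (exists x y, [/\ x \in A, adj x y, y \in U & y \notin A]).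
  apply: (IH (y :: A)) => //; last by rewrite /= addSn -addnS.
    exact: animal_cons aA xA xy yA.
  by move=> z; rewrite inE => /predU1P[->|/AU].
exists A => // x y xA xy yU; apply/negPn/negP => yA; apply: H.
by exists x, y.
Qed.

Lemma leq_sum_reindex A (h : site d -> site d) (f : site d -> nat) :
  uniq A -> injective h ->
  (\sum_(x <- A) (h x \in A) * f (h x) <= \sum_(y <- A) f y)%N.
Proof.
move=> uA hi.
rewrite (eq_bigr (fun x => if h x \in A then f (h x) else 0)%N); last first.
  by move=> x _; case: (h x \in A); rewrite ?mul1n.
rewrite -big_mkcond -big_filter -(big_map h xpredT f).
apply: (@leq_trans (\sum_(y <- [seq y <- A | y \in [seq h i | i <- A & h i \in A]]) f y)).
  apply: eq_leq; apply: perm_big; apply: uniq_perm.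
  - by rewrite map_inj_uniq // filter_uniq.
  - exact: filter_uniq.
  - move=> y; rewrite mem_filter; case: (boolP (y \in [seq h i | i <- A & h i \in A])) => //=.
    by move=> /mapP[x]; rewrite mem_filter => /andP[hA _] ->.
rewrite big_filter [leqRHS](bigID (fun y => y \in [seq h i | i <- A & h i \in A])) /=.
exact: leq_addr.
Qed.

(* [v x] topplings happen at [x] before the last one, which happens at time
   [l x]; the term [l y < l x] counts that of [y] when it precedes that of
   [x]. Each of the at most [d * size A] unordered edges of [A] contributes to
   at most one of its two ends. *)
Lemma cluster_mass (disp : Order.disp_t) (T : porderType disp) A (eta v : site d -> nat)
    (l : site d -> T) : uniq A ->
  (forall x, x \in A -> (2 * d + 2 * d * v x <=
     eta x + nbr_sum (fun y => (y \in A) * (v y + (l y < l x)%O)) x)%N) ->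
  (d * size A <= \sum_(x <- A) eta x)%N.
Proof.
move=> uA H.
have addi (e : site d) : injective (fun x => x + e) by move=> x y /addIr.
(* Each edge in direction [i] is charged to its lower end [x]: [p] marks that the lower end has the
   earlier last toppling, [q] that the upper end has. They exclude each other, whence [H3]. *)
pose p (i : 'I_d) (x : site d) : nat := (((x + unit_vec i)%R \in A) * (l x < l (x + unit_vec i)%R)%O)%N.
pose q (i : 'I_d) (x : site d) : nat := (((x + unit_vec i)%R \in A) * (l (x + unit_vec i)%R < l x)%O)%N.
have : (\sum_(x <- A) (2 * d + 2 * d * v x) <=
   \sum_(x <- A) eta x + (2 * d * (\sum_(x <- A) v x) + d * size A))%N.
  apply: (@leq_trans (\sum_(x <- A) (eta x +
     nbr_sum (fun y => (y \in A) * (v y + (l y < l x)%O)) x))%N).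
    by rewrite big_seq [leqRHS]big_seq; apply: leq_sum.
  rewrite big_split leq_add2l /nbr_sum exchange_big /=.
  apply: (@leq_trans (\sum_(i < d) (2 * (\sum_(x <- A) v x) + size A))%N); last first.
    by rewrite sum_nat_const card_ord; lia.
  apply: leq_sum => i _.
  rewrite big_split /=.
  have H1 : (\sum_(x <- A) ((x + unit_vec i)%R \in A) * (v (x + unit_vec i)%R + (l (x + unit_vec i)%R < l x)%O)
     <= \sum_(x <- A) v x + \sum_(x <- A) q i x)%N.
    rewrite (eq_bigr (fun x => ((x + unit_vec i)%R \in A) * v (x + unit_vec i)%R + q i x)%N).
      by rewrite big_split leq_add2r; apply: (leq_sum_reindex A _ v).
    by move=> x _; rewrite mulnDr.
  (* Translating by [- unit_vec i] moves the contribution of the edge from [x] to its lower end. *)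
  have H2 : (\sum_(x <- A) ((x - unit_vec i)%R \in A) * (v (x - unit_vec i)%R + (l (x - unit_vec i)%R < l x)%O)
     <= \sum_(x <- A) v x + \sum_(x <- A) p i x)%N.
    rewrite -big_split.
    apply: leq_trans (leq_sum_reindex A (fun x => x - unit_vec i) (fun x => v x + p i x)%N uA (addi _)).
    rewrite big_seq [leqRHS]big_seq; apply: leq_sum => x xA.
    by rewrite /p subrK xA mul1n.
  have H3 : (\sum_(x <- A) q i x + \sum_(x <- A) p i x <= size A)%N.
    rewrite -big_split -sum1_size; apply: leq_sum => x _ /=.
    rewrite /p /q; case: (_ \in A) => //; rewrite !mul1n.
    by have [/lt_gtF->|] := boolP (l x < l (x + unit_vec i)%R)%O; rewrite ?addn0 ?add0n ?leq_b1.
  apply: leq_trans (leq_add H1 H2) _.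
  by rewrite addnACA addnn mul2n leq_add2l.
rewrite big_split big_const_seq count_predT iter_addn_0 -big_distrr /=.
by rewrite addnCA addnC leq_add2l; lia.
Qed.

End Animals.

(** * Finite witnesses of stabilization *)
Section Stabilization.
Variables (R : realType) (d : nat) (eta : site d -> nat).
Implicit Types (tau : procedure R d) (p q : site d * R).

(** Well-founded induction on topplings: choosing a bad predecessor over and over would build an
    infinite backward chain, which legality forbids. *)
Lemma chain_ind tau (bad : site d * R -> Prop) : legal_stabilizing eta tau ->
  (forall p, bad p -> p.2 \in tau p.1) ->
  (forall p, bad p -> exists q, [/\ bad q, adj p.1 q.1 & q.2 < p.2]) ->
  forall p, ~ bad p.
Proof.
move=> [_ [_ [nochain _]]] badP step p0 bad0.
have /choice[f fP] p : exists q, bad p -> [/\ bad q, adj p.1 q.1 & q.2 < p.2].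
  have [/step[q qP]|nb] := pselect (bad p); first by exists q.
  by exists p.
have badi k : bad (iter k f p0) by elim: k => //= k /fP[].
apply: nochain; exists (fun k => (iter k f p0).1), (fun k => (iter k f p0).2) => k.
by have [_ ? ?] := fP _ (badi k); split; [exact: badP|].
Qed.

Lemma nbr_sum_lt (f g : site d -> nat) x : (nbr_sum f x < nbr_sum g x)%N ->
  exists2 y, adj x y & (f y < g y)%N.
Proof.
move=> H; apply: contrapT => nH; move: H; apply/negP; rewrite -leqNgt.
apply: leq_sum => i _; apply: leq_add; rewrite leqNgt; apply/negP => H; apply: nH.
  by exists (x + unit_vec i) => //; exists i; left.
by exists (x - unit_vec i) => //; exists i; right.
Qed.

Lemma procedure_uniq tau x : legal_stabilizing eta tau -> uniq (tau x).
Proof. by case=> /(_ x)[_ /lt_sorted_uniq]. Qed.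

(** Least action principle. If [x] topples in [tau] after using up its count in [tau'], legality of
    [tau] at that time and final stability of [tau'] force a neighbour to have exceeded its own
    count strictly earlier; [chain_ind] excludes this regress. *)
Lemma least_action tau tau' x t :
  legal_stabilizing eta tau -> legal_stabilizing eta tau' ->
  t \in tau x -> (ntop_before tau x t < size (tau' x))%N.
Proof.
move=> ltau ltau' tx; rewrite ltnNge; apply/negP => bad.
apply: (chain_ind tau (fun p => p.2 \in tau p.1 /\
   (size (tau' p.1) <= ntop_before tau p.1 p.2)%N) ltau _ _ (x, t)) => // [p []//|].
move=> {x t tx bad} [x t] [/= tx bad].
have [_ [legal _]] := ltau; have [_ [_ [_ stable]]] := ltau'.
have [y xy lty] : exists2 y, adj x y & (size (tau' y) < ntop_before tau y t)%N.
  apply: nbr_sum_lt.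
  have := legal _ _ tx; have := stable x.
  have : (2 * d * size (tau' x) <= 2 * d * ntop_before tau x t)%N by rewrite leq_mul2l bad orbT.
  lia.
(* the toppling of [y] that exceeds its number of topplings in [tau'] *)
set s := nth 0 (tau y) (size (tau' y)).
have sz : (size (tau' y) < size (tau y))%N by apply: leq_trans lty (count_size _ _).
have [/(_ y)[_ sy] _] := ltau.
have ys : s \in tau y by apply: mem_nth.
have cnt : ntop_before tau y s = size (tau' y).
  rewrite /ntop_before -(cat_take_drop (size (tau' y)) (tau y)) count_cat.
  rewrite (@eq_in_count _ _ predT) ?count_predT ?size_take ?sz; last first.
    move=> r /(nthP 0)[i]; rewrite size_take sz => ilt <-.
    rewrite nth_take // /s /=; apply/idP.
    by apply: (sorted_ltn_nth lt_trans) => //; rewrite inE //; apply: ltn_trans sz.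
  rewrite (@eq_in_count _ _ pred0) ?count_pred0 ?addn0 // => r /(nthP 0)[i].
  rewrite size_drop => ilt <-; rewrite nth_drop /s /=; apply/negbTE; rewrite -leNgt.
  apply: (sorted_leq_nth le_trans le_refl 0 (sub_sorted (@ltW _ _) sy)); rewrite ?inE //; last exact: leq_addr.
  by rewrite -ltn_subRL.
exists (y, s); split => //=; first by rewrite cnt.
rewrite ltNge; apply/negP => ts; move: lty; rewrite -cnt; apply/negP; rewrite -leqNgt.
by apply: sub_count => r /= /lt_le_trans; apply.
Qed.

(** [T_infty] may use a different procedure for each site; this brings all of them back to one fixed
    [tau]. *)
Lemma T_infty_size tau x : legal_stabilizing eta tau ->
  T_infty R eta x -> (0 < size (tau x))%N.
Proof.
move=> ltau [tau' [ltau' ]]; case: (tau' x) (fun t => least_action tau' tau x t ltau' ltau) => // t s /(_ t).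
by rewrite inE eqxx => /(_ isT) H _; apply: leq_trans H.
Qed.

(** A finite history of [tau], closed under direct causes: whatever happened earlier at the same
    site or next to it is recorded too. *)
Definition closed_topplings tau (S : seq (site d * R)) : Prop :=
  (forall p, p \in S -> p.2 \in tau p.1) /\
  (forall p q, p \in S -> q.1 = p.1 \/ adj p.1 q.1 -> q.2 \in tau q.1 ->
     q.2 < p.2 -> q \in S).

Lemma closed_flatten tau (I : eqType) (s : seq I) (S : I -> seq (site d * R)) :
  (forall i, i \in s -> closed_topplings tau (S i)) ->
  closed_topplings tau (flatten [seq S i | i <- s]).
Proof.
move=> H; split.
  by move=> p /flatten_mapP[i /H[+ _]] => /[apply].
by move=> p q /flatten_mapP[i si pS] *; apply/flatten_mapP; exists i => //;
  have [_ Hi] := H _ si; apply: (Hi p).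
Qed.

(* Every toppling has finitely many direct causes, so without infinite
   backward chains it has finitely many causes. *)
Lemma causes_finite tau x t : legal_stabilizing eta tau -> t \in tau x ->
  exists2 S, closed_topplings tau S & (x, t) \in S.
Proof.
move=> ltau tx; apply: contrapT => bad.
apply: (chain_ind tau (fun p => p.2 \in tau p.1 /\
   ~ exists2 S, closed_topplings tau S & p \in S) ltau _ _ (x, t)) => // [p []//|].
move=> {x t tx bad} [x t] [/= tx bad]; apply: contrapT => nq; apply: bad.
pose D := [seq p <- [seq (y, s) | y <- nbrs d x, s <- tau y] | p.2 < t].
have DP q : q \in D <-> [/\ adj x q.1, q.2 \in tau q.1 & q.2 < t].
  rewrite mem_filter; split.
    by case/andP => qt /allpairsPdep[y [s [yx sy Eq]]]; move: qt;
      rewrite Eq /= => qt; split => //; apply/adj_nbrs.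
  case: q => y s [/= /adj_nbrs yx sy ->] /=.
  by apply/allpairsPdep; exists y, s.
have /choice[S SP] q : exists S, q \in D -> closed_topplings tau S /\ q \in S.
  have [qD|qD] := boolP (q \in D); last by exists [::].
  apply: contrapT => nS; apply: nq; have /DP[? ? ?] := qD.
  exists q; split => //; split => // -[S ? ?].
  by apply: nS; exists S.
have [SD1 SD2] : closed_topplings tau (flatten [seq S q | q <- D]).
  by apply: closed_flatten => q /SP[].
(* Earlier topplings of [x] itself are added directly: their neighbouring causes also precede [t],
   hence already lie in [D]. *)
exists ([seq (x, s) | s <- tau x & s <= t] ++ flatten [seq S q | q <- D]); last first.
  by rewrite mem_cat map_f // mem_filter lexx.
split.
  move=> p; rewrite mem_cat => /orP[/mapP[s]|/SD1//].
  by rewrite mem_filter => /andP[_ sx] ->.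
move=> p q; rewrite mem_cat => /orP[/mapP[s]|pS]; last first.
  by move=> *; rewrite mem_cat (SD2 p q) ?orbT.
rewrite mem_filter => /andP[st sx] -> /= qx qt qs.
have qt' : q.2 < t by apply: lt_le_trans st.
rewrite mem_cat; case: qx => [qx|qx].
  apply/orP; left; apply/mapP; exists q.2; last by case: q qx {qt qs qt'} => ? ? /= ->.
  by rewrite mem_filter ltW // -qx.
have /SP[_ qS] : q \in D by apply/DP.
apply/orP; right; apply/flatten_mapP; exists q => //; exact/DP.
Qed.

Lemma causes_finite_seq tau (F : seq (site d)) : legal_stabilizing eta tau ->
  (forall x, x \in F -> (0 < size (tau x))%N) ->
  exists2 S, closed_topplings tau S & {subset F <= [seq p.1 | p <- S]}.
Proof.
move=> ltau HF.
have /choice[S SP] x : exists S, x \in F -> closed_topplings tau S /\ (x \in [seq p.1 | p <- S]).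
  have [xF|xF] := boolP (x \in F); last by exists [::].
  have := HF _ xF; case E : (tau x) => [//|t r] _.
  have tx : t \in tau x by rewrite E inE eqxx.
  have [S ? xS] := causes_finite tau x t ltau tx.
  by exists S => _; split => //; apply/mapP; exists (x, t).
exists (flatten [seq S x | x <- F]).
  by apply: closed_flatten => x /SP[].
move=> x xF; have [_ /mapP[p pS xp]] := SP _ xF.
by apply/mapP; exists p => //; apply/flatten_mapP; exists x.
Qed.

Lemma seq_max_time (S : seq (site d * R)) x : x \in [seq p.1 | p <- S] ->
  exists2 t, (x, t) \in S & forall s, (x, s) \in S -> s <= t.
Proof.
elim: S => //= -[y r] S IH; rewrite inE /= => xS.
have [/IH[t tS tmax]|nxS] := boolP (x \in [seq p.1 | p <- S]).
  have [xy|xy] := eqVneq x y; last first.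
    exists t; first by rewrite inE tS orbT.
    by move=> s; rewrite inE xpair_eqE (negbTE xy) /=; exact: tmax.
  exists (Num.max r t).
    by rewrite xy inE; case: leP => _; rewrite ?eqxx // -xy tS orbT.
  by move=> s; rewrite inE le_max => /orP[/eqP[_ ->]|/tmax->]; rewrite ?lexx ?orbT.
move: xS; rewrite (negbTE nxS) orbF => /eqP xy.
exists r; first by rewrite xy inE eqxx.
move=> s; rewrite inE => /orP[/eqP[_ ->]//|xs].
by case/mapP: nxS; exists (x, s).
Qed.

(** Paths from the origin to [n] cluster sites visit a finite set [F]. A finite history [S] covering
    [F] has sites [U], and [A] is the component of [0] in [U]; it contains all the paths.
    [cluster_mass] is applied with [l x] the last toppling time of [x] within [S]. *)
Lemma cluster_animal n : (0 < n)%N -> card_ge (component (T_infty R eta) 0) n ->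
  exists A, [/\ animal d A, (n <= size A)%N & (d * size A <= \sum_(x <- A) eta x)%N].
Proof.
move=> n0 [s [us [sn sC]]].
have /choice[kp kpP] y : exists kp : nat * (nat -> site d), y \in s ->
    [/\ kp.2 0%N = 0, kp.2 kp.1 = y, forall j, (j <= kp.1)%N -> T_infty R eta (kp.2 j) &
     forall j, (j < kp.1)%N -> adj (kp.2 j) (kp.2 j.+1)].
  have [/sC[k [p [? [? [? ?]]]]]|] := boolP (y \in s); last by exists (0%N, fun=> 0).
  by exists (k, p).
have [y0 y0s] : exists y, y \in s by case: s sn n0 {us sC kpP} => [<-//|y s _ _]; exists y; rewrite inE eqxx.
have [tau ltau] : exists tau, @legal_stabilizing R d eta tau.
  by have [_ _ /(_ 0%N isT)[tau [? _]] _] := kpP _ y0s; exists tau.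
pose F := flatten [seq [seq (kp y).2 j | j <- iota 0 (kp y).1.+1] | y <- s].
have FP x : x \in F -> (0 < size (tau x))%N.
  move=> /flatten_mapP[y ys] /mapP[j]; rewrite mem_iota add0n => jk ->.
  by have [_ _ H _] := kpP _ ys; apply: T_infty_size => //; apply: H.
have [S [S1 S2] FS] := causes_finite_seq tau F ltau FP.
set U := [seq p.1 | p <- S] in FS.
have pF y j : y \in s -> (j <= (kp y).1)%N -> (kp y).2 j \in F.
  by move=> ys jk; apply/flatten_mapP; exists y => //; apply: map_f; rewrite mem_iota.
have U0 : 0 \in U.
  by apply: FS; have [<- _ _ _] := kpP _ y0s; apply: pF.
have [A [aA AU] Acl] := animal_closed_in d U U0.
have A0 : 0 \in A.
  by elim: aA {AU Acl} => [|B x y _ B0 _ _ _]; rewrite inE ?eqxx // B0 orbT.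
exists A; split => //.
  rewrite -sn; apply: uniq_leq_size => // y ys.
  have [p0 pk _ padj] := kpP _ ys.
  suff H j : (j <= (kp y).1)%N -> (kp y).2 j \in A by rewrite -pk; apply: H.
  elim: j => [|j IH] jk; first by rewrite p0.
  by apply: (Acl _ _ (IH (ltnW jk)) (padj _ jk)); apply/FS/pF.
have /choice[l lP] x : exists t, x \in U -> (x, t) \in S /\ forall s, (x, s) \in S -> s <= t.
  have [/seq_max_time[t ? ?]|] := boolP (x \in U); last by exists 0.
  by exists t.
apply: (cluster_mass d _ _ A eta (fun x => ntop_before tau x (l x)) l).
  exact: animal_uniq.
move=> x xA; have [lS lmax] := lP _ (AU _ xA).
have [_ [legal _]] := ltau.
apply: leq_trans (legal x (l x) (S1 _ lS)) _.
rewrite leq_add2l.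
(* A neighbour outside [A] has not toppled before [l x]: closure of [S] would put such a toppling in
   [S], hence its site in [U] and in [A]. *)
have before y : adj x y -> (ntop_before tau y (l x) <=
    (y \in A) * (ntop_before tau y (l y) + (l y < l x)%R))%N.
  move=> xy; have [yA|yA] := boolP (y \in A); last first.
    rewrite mul0n leqn0 /ntop_before -leqn0 leqNgt -has_count; apply/hasPn => r ry.
    apply/negP => rx; move/negP: yA; apply; apply: (Acl _ _ xA xy).
    by apply/mapP; exists (y, r) => //; apply: (S2 (x, l x)) => //=; right.
  rewrite mul1n; have [yS ymax] := lP _ (AU _ yA).
  have [yx|xy'] := ltP (l y) (l x); last first.
    by rewrite addn0; apply: sub_count => r /= /lt_le_trans; apply.
  (* The extra [1] is the toppling at [l y] itself. No later toppling of [y] precedes [l x], since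
     it would belong to [S] and contradict the maximality of [l y]. *)
  have -> : (ntop_before tau y (l y) + 1)%N = count (fun s => s <= l y) (tau y).
    rewrite (eq_count (a2 := predU (fun s => s < l y) (pred1 (l y)))); last first.
      by move=> r /=; rewrite le_eqVlt orbC.
    have := count_predUI (fun s => s < l y) (pred1 (l y)) (tau y).
    rewrite [X in (_ + X)%N](@eq_count _ _ pred0) ?count_pred0 ?addn0; last first.
      by move=> r /=; have [->|] := eqVneq r (l y); rewrite ?ltxx ?andbF.
    by rewrite count_uniq_mem ?(procedure_uniq _ _ ltau) // (S1 _ yS).
  rewrite /ntop_before -!size_filter; apply: uniq_leq_size; first by rewrite filter_uniq // (procedure_uniq _ _ ltau).
  move=> r; rewrite !mem_filter => /andP[rx ry]; rewrite ry andbT; apply: ymax.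
  by apply: (S2 (x, l x)) => //=; right.
by apply: leq_sum => i _; apply: leq_add; apply: before; exists i; [left|right].
Qed.

End Stabilization.

(** * Enumeration of lattice animals *)
Section Walks.
Variable d : nat.

Definition step (x : site d) (a : 'I_d * bool) : site d :=
  if a.2 then x + unit_vec a.1 else x - unit_vec a.1.

Definition visited (w : seq ('I_d * bool)) : seq (site d) := 0 :: scanl step 0 w.

Lemma mem_visited_split (x : site d) w : x \in visited w ->
  exists w1 w2, w = w1 ++ w2 /\ foldl step 0 w1 = x.
Proof.
rewrite /visited; elim: w 0 => [|a w IH] o /=.
  by rewrite inE => /eqP->; exists [::], [::].
rewrite inE => /predU1P[->|/IH[w1 [w2 [-> <-]]]]; first by exists [::], (a :: w).
by exists (a :: w1), w2.
Qed.

(* A new site [y] adjacent to the visited site [x] is reached by a detour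
   [x -> y -> x], which costs two steps. *)
Lemma animal_walk (A : seq (site d)) : animal d A ->
  exists w, size w = (size A).-1.*2 /\ visited w =i A.
Proof.
elim=> {A} [|A x y aA [w [sw wA]] xA [i xy] yA]; first by exists [::].
have [w1 [w2 [Ew Ex]]] : exists w1 w2, w = w1 ++ w2 /\ foldl step 0 w1 = x.
  by apply: mem_visited_split; rewrite wA.
pose b : bool := (y == x + unit_vec i).
have E1 : step x (i, b) = y.
  by rewrite /step /b /=; case: eqVneq => [->//|]; case: xy => ->; rewrite ?eqxx.
have E2 : step y (i, ~~ b) = x.
  rewrite -E1 /step /=; case: (b) => /=; first by rewrite addrK.
  by rewrite subrK.
exists (w1 ++ [:: (i, b); (i, ~~ b)] ++ w2); split.
  have A0 : (0 < size A)%N by case: (A) xA.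
  move: sw; rewrite Ew !size_cat /= => sw.
  lia.
move=> z; have := wA z; rewrite Ew /visited !scanl_cat /= Ex E1 E2.
rewrite !inE !mem_cat !inE => <-.
(* The return to [x] adds no site, because [x] is the endpoint of [w1] and already visited. *)
have : (z == x) ==> (z == 0) || (z \in scanl step 0 w1).
  apply/implyP => /eqP->; rewrite -Ex.
  by case: (lastP w1) => [|w' a]; rewrite ?eqxx // foldl_rcons -cats1 scanl_cat mem_cat /= mem_head !orbT.
by case: (z == x); case: (z == y); case: (z == 0); case: (z \in scanl step 0 w1); case: (z \in _).
Qed.

(** Indexed by size minus one. The same set may occur many times or in several orders, which is
    harmless for a union bound. *)
Definition walk_sets (m : nat) : seq (seq (site d)) :=
  [seq s <- [seq undup (visited w) | w : (m.*2).-tuple ('I_d * bool)] | size s == m.+1].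

Lemma walk_sets_uniq m s : s \in walk_sets m -> uniq s /\ size s = m.+1.
Proof.
rewrite mem_filter => /andP[/eqP sm /mapP[w _ Es]]; split=> //.
by rewrite Es undup_uniq.
Qed.

Lemma size_walk_sets m : (size (walk_sets m) <= (2 * d) ^ m.*2)%N.
Proof.
rewrite size_filter; apply: leq_trans (count_size _ _) _.
by rewrite size_map -cardE card_tuple card_prod card_ord card_bool mulnC.
Qed.

Lemma animal_walk_sets A : animal d A ->
  exists2 s, s \in walk_sets (size A).-1 & perm_eq s A.
Proof.
move=> aA; have [w [sw wA]] := animal_walk A aA.
have pA : perm_eq (undup (visited w)) A.
  by apply: uniq_perm; rewrite ?undup_uniq ?(animal_uniq d A aA) // => z; rewrite mem_undup wA.
exists (undup (visited w)) => //.
rewrite mem_filter (perm_size pA) prednK; last by case: aA.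
rewrite eqxx /=; apply/mapP; exists (tcast sw (in_tuple w)); first by rewrite mem_enum.
by rewrite val_tcast.
Qed.

End Walks.

Definition zinterval (a b : nat) : seq (site 1) :=
  [seq const_mx (k%:Z - a%:Z) | k <- iota 0 (a + b).+1].

Lemma mem_zinterval a b (x : site 1) :
  (x \in zinterval a b) = (- a%:Z <= x 0 0 <= b%:Z).
Proof.
apply/mapP/idP => [[k]|H].
  by rewrite mem_iota => klt ->; rewrite mxE; lia.
exists (absz (x 0 0 + a%:Z)); first by rewrite mem_iota; lia.
apply/matrixP => i j; rewrite mxE !ord1; move: (x 0 0) H => y H; lia.
Qed.

Lemma zinterval_uniq a b : uniq (zinterval a b).
Proof.
rewrite map_inj_uniq ?iota_uniq // => j k /matrixP /(_ 0 0); rewrite !mxE; lia.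
Qed.

Lemma size_zinterval a b : size (zinterval a b) = (a + b).+1.
Proof. by rewrite size_map size_iota. Qed.

(** A new site adjacent to an interval prolongs it by one at the left or right end. *)
Lemma animal_zinterval A : animal 1 A -> exists a b, perm_eq (zinterval a b) A.
Proof.
move=> aA; suff [a [b H]] : exists a b, A =i zinterval a b.
  exists a, b; apply: uniq_perm; rewrite ?zinterval_uniq ?(animal_uniq 1 A aA) //.
elim: aA => {A} [|A x y aA [a [b AE]] xA [i xy] yA].
  exists 0%N, 0%N => x; rewrite [RHS]mem_zinterval inE; apply/eqP/idP => [->|]; first by rewrite mxE.
  by move=> H; apply/matrixP => i j; rewrite mxE !ord1; move: (x 0 0) H => y H; lia.
have xyE : y 0 0 = x 0 0 + 1 \/ y 0 0 = x 0 0 - 1.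
  by case: xy => ->; [left|right]; rewrite ord1 !mxE.
move: xA yA; rewrite !AE !mem_zinterval => xA yA.
have eqy z : (z == y) = (z 0 0 == y 0 0).
  apply/eqP/eqP => [->//|H]; by apply/matrixP => k l; rewrite !ord1.
have [ya|ya] := leP (- a%:Z) (y 0 0).
  exists a, b.+1 => z; rewrite mem_zinterval inE AE mem_zinterval eqy.
move: (x 0 0) (y 0 0) (z 0 0) xA yA xyE ya {eqy} => p q r; lia.
exists a.+1, b => z; rewrite mem_zinterval inE AE mem_zinterval eqy.
move: (x 0 0) (y 0 0) (z 0 0) xA yA xyE ya {eqy} => p q r; lia.
Qed.

(** There are only [m + 1] intervals of [m + 1] sites through the origin. This linear count is
    beaten by any geometric decay, so no smallness of the density is required. *)
Definition zintervals (m : nat) : seq (seq (site 1)) :=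
  [seq zinterval a (m - a) | a <- iota 0 m.+1].

Lemma zintervals_uniq m s : s \in zintervals m -> uniq s /\ size s = m.+1.
Proof.
move=> /mapP[a]; rewrite mem_iota => am ->; rewrite zinterval_uniq size_zinterval; split=> //; lia.
Qed.

Lemma animal_zintervals A : animal 1 A ->
  exists2 s, s \in zintervals (size A).-1 & perm_eq s A.
Proof.
move=> aA; have [a [b abA]] := animal_zinterval A aA.
exists (zinterval a b) => //; apply/mapP; exists a; rewrite -(perm_size abA) size_zinterval ?mem_iota /=.
  by lia.
by congr zinterval; lia.
Qed.

Lemma zintervals_sub m N s : (m <= N)%N -> s \in zintervals m -> {subset s <= zinterval N N}.
Proof.
move=> mN /mapP[a]; rewrite mem_iota => am -> x; rewrite !mem_zinterval; lia.
Qed.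

(** * Heavy sets under a product measure *)
Section IID.
Context {R : realType} {d0 : measure_display} {Omega : measurableType d0}
  (P : probability Omega R) {d : nat} (eta : Omega -> site d -> nat).
Hypothesis iid : iid_field P eta.

Lemma measurable_site d1 (T : sigmaRingType d1) (f : nat -> T) x :
  measurable_fun setT (fun w => f (eta w x)).
Proof.
move=> _ Y _; rewrite setTI.
rewrite (_ : _ @^-1` _ = \bigcup_(k in [set k | Y (f k)]) [set w | eta w x = k]).
  by apply: bigcup_measurable => k _; apply: iid.1.
apply/seteqP; split => [w Yw|w [k Yk wk]]; first by exists (eta w x).
by rewrite /preimage /= wk.
Qed.

(** For empty [s] this is the whole space, so estimates on cylinders also cover the unconditioned
    case. *)
Definition cylinder (s : seq (site d)) (k : site d -> nat) : set Omega :=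
  \bigcap_(x in [set` s]) [set w | eta w x = k x].

Lemma measurable_cylinder s k : measurable (cylinder s k).
Proof.
apply: fin_bigcap_measurable; first exact: finite_seq.
by move=> x _; apply: iid.1.
Qed.

Lemma cylinder_cons x s k : cylinder (x :: s) k = [set w | eta w x = k x] `&` cylinder s k.
Proof. by rewrite /cylinder !bigcap_seq big_cons. Qed.

Lemma prob_cylinder_cons x s k : uniq (x :: s) ->
  P (cylinder (x :: s) k) = (P [set w | eta w 0%R = k x] * P (cylinder s k))%E.
Proof.
move=> u; have us : uniq s by case/andP: u.
by rewrite /cylinder !iid.2.2 // big_cons iid.2.1.
Qed.

Lemma integral_site_split (D : set Omega) x (f : Omega -> R) : measurable D ->
  measurable_fun setT f -> (forall w, 0 <= f w) ->
  (\int[P]_(w in D) (f w)%:E =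
   \sum_(0 <= k <oo) \int[P]_(w in [set w | eta w x = k] `&` D) (f w)%:E)%E.
Proof.
move=> mD mf f0.
have ED : D = \bigcup_k ([set w | eta w x = k] `&` D).
  apply/seteqP; split => [w Dw|w [k _ []//]].
  by exists (eta w x).
rewrite {1}ED ge0_integral_bigcup //.
- by move=> k; apply: measurableI => //; apply: iid.1.
- by apply/measurable_EFinP; apply: measurable_funTS.
- by move=> w _; rewrite lee_fin.
by move=> i j _ _ [w [[/= -> _] [/= -> _]]].
Qed.

Lemma expect_site (f : nat -> R) : (forall k, 0 <= f k) ->
  (\int[P]_w (f (eta w 0%R))%:E =
   \sum_(0 <= k <oo) (f k)%:E * P [set w | eta w 0%R = k])%E.
Proof.
move=> f0; rewrite (integral_site_split _ 0) //; last exact: measurable_site.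
apply: eq_eseriesr => k _; rewrite setIT.
rewrite (eq_integral (cst (f k)%:E)) ?integral_cst //; first exact: iid.1.
by move=> w; rewrite inE /= => ->.
Qed.

(** [iid_field] speaks of cylinder probabilities only, so independence is extracted one site at a
    time: partition by the value at [x], which moves [x] from the product into the cylinder. *)
Lemma expect_prod_cylinder (f : nat -> R) (g : R) (s1 s2 : seq (site d)) k :
  (forall k, 0 <= f k) -> (\int[P]_w (f (eta w 0%R))%:E = g%:E)%E ->
  uniq (s1 ++ s2) ->
  (\int[P]_(w in cylinder s2 k) (\prod_(x <- s1) f (eta w x))%:E =
   (g ^+ size s1)%:E * P (cylinder s2 k))%E.
Proof.
move=> f0 Ef.
elim: s1 s2 k => [|x s1 IH] s2 k us.
  under eq_integral do rewrite big_nil.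
  by rewrite integral_cst //; exact: measurable_cylinder.
have us2 : uniq (x :: s2).
  by move: us; rewrite /= mem_cat cat_uniq negb_or => /andP[/andP[_ ->] /and3P[]].
have us1 : uniq (s1 ++ x :: s2) by rewrite -cat1s uniq_catCA.
have mprod s : measurable_fun setT (fun w => \prod_(x <- s) f (eta w x)).
  by apply: measurable_prod => y _; exact: (measurable_site _ _ f).
have prod0 s w : 0 <= \prod_(x <- s) f (eta w x) by apply: prodr_ge0.
rewrite (integral_site_split _ x) //; last exact: measurable_cylinder.
pose kj j y := if y == x then j else k y.
have cylj j : [set w | eta w x = j] `&` cylinder s2 k = cylinder (x :: s2) (kj j).
  rewrite cylinder_cons /kj eqxx; congr (_ `&` _).
  apply: eq_bigcapr => y /= ys; case: eqVneq => // yx.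
  by move: us2; rewrite /= -yx ys.
have cyljP j : P (cylinder s2 (kj j)) = P (cylinder s2 k).
  congr (P _); apply: eq_bigcapr => y /= ys; rewrite /kj; case: eqVneq => // yx.
  by move: us2; rewrite /= -yx ys.
rewrite (eq_eseriesr (g := fun j => ((g ^+ size s1)%:E * P (cylinder s2 k)) *
   ((f j)%:E * P [set w | eta w 0%R = j]))%E); last first.
  move=> j _; rewrite cylj.
  rewrite (eq_integral (fun w => (f j)%:E * (\prod_(x <- s1) f (eta w x))%:E)%E); last first.
    move=> w; rewrite inE cylinder_cons => -[/= wj _].
    by rewrite big_cons EFinM wj /kj eqxx.
  rewrite ge0_integralZl_EFin //; last 3 first.
  - exact: measurable_cylinder.
  - by move=> w _; rewrite lee_fin.
  - by apply/measurable_EFinP; apply: measurable_funTS.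
  rewrite IH // prob_cylinder_cons // cyljP /kj eqxx.
  by rewrite muleCA -[RHS]muleA; congr (_ * _)%E; rewrite [RHS]muleC muleA.
rewrite -[P (cylinder s2 k)]fineK ?fin_num_measure //; last exact: measurable_cylinder.
rewrite -EFinM nneseriesZl; last first.
  by move=> i _; apply: mule_ge0 => //; rewrite lee_fin.
by rewrite -expect_site // Ef -!EFinM exprSr mulrAC.
Qed.

Definition heavy (s : seq (site d)) : set Omega :=
  [set w | (d * size s <= \sum_(x <- s) eta w x)%N].

Lemma measurable_heavy s : measurable (heavy s).
Proof.
rewrite (_ : heavy s = setT `&` (fun w => \sum_(x <- s) (eta w x)%:R) @^-1` `[(d * size s)%:R : R, +oo[).
  apply: measurable_sum => // x. exact: (measurable_site _ _ (fun k => k%:R : R)).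
rewrite setTI; apply/seteqP; split => w; rewrite /heavy /= in_itv /= andbT -natr_sum ler_nat //.
Qed.

(** On the cylinder the sites of [I] are empty, so all grains of [s] sit on [s'], outside [I].
    Markov's inequality there gives the power [size s'] of [g], and [1 <= g] raises it to
    [size s]. *)
Lemma chernoff_cylinder (I s : seq (site d)) (t g : R) : uniq I -> uniq s ->
  0 <= t -> mgf P eta t = g%:E ->
  (P (cylinder I (fun=> 0%N) `&` heavy s) <=
   P (cylinder I (fun=> 0%N)) * ((expR (- (t * d%:R)) * g) ^+ size s)%:E)%E.
Proof.
move=> uI us t0 Eg.
set Z := cylinder I _.
pose s' := [seq x <- s | x \notin I].
have g1 : 1 <= g.
  rewrite -lee_fin -Eg -(@probability_setT _ _ _ P) -[leLHS]mul1e -integral_cst //.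
  apply: ge0_le_integral => //.
    by apply/measurable_EFinP; apply: (measurable_site _ _ (fun k => expR (t * k%:R))).
  by move=> w _; rewrite lee_fin -expR0 ler_expR mulr_ge0.
have mZ : measurable Z by exact: measurable_cylinder.
have mZB : measurable (Z `&` heavy s) by apply: measurableI => //; exact: measurable_heavy.
have mF : measurable_fun setT (fun w => \prod_(x <- s') expR (t * (eta w x)%:R)).
  by apply: measurable_prod => y _; exact: (measurable_site _ _ (fun k => expR (t * k%:R))).
have F0 w : 0 <= \prod_(x <- s') expR (t * (eta w x)%:R).
  by apply: prodr_ge0 => x _; exact: expR_ge0.
pose c : R := expR (t * (d * size s)%:R).
have H1 : (c%:E * P (Z `&` heavy s) <= (g ^+ size s')%:E * P Z)%E.
  rewrite -(expect_prod_cylinder (fun k => expR (t * k%:R)) g s' I) //; last first.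
    rewrite cat_uniq filter_uniq // uI andbT; apply/hasPn => x xI.
    by rewrite mem_filter xI.
  rewrite -integral_cst //.
  apply: (@le_trans _ _ (\int[P]_(w in Z `&` heavy s) (\prod_(x <- s') expR (t * (eta w x)%:R))%:E)%E); last first.
    apply: ge0_subset_integral => //.
      by apply/measurable_EFinP; apply: measurable_funTS.
    by move=> w _; rewrite lee_fin.
  apply: ge0_le_integral => //.
  - by move=> w _; rewrite lee_fin expR_ge0.
  - by apply/measurable_EFinP; apply: measurable_funTS.
  move=> w [Zw Bw]; rewrite lee_fin -expR_sum ler_expR -mulr_sumr ler_wpM2l //.
  rewrite -natr_sum ler_nat; apply: (leq_trans Bw).
  rewrite big_filter [leqLHS](bigID (fun x => x \notin I)) /=.
  rewrite [X in (_ + X)%N]big1_seq ?addn0 // => x /andP[xI _].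
  by apply: Zw; move: xI => /=; rewrite negbK.
have c0 : 0 < c by exact: expR_gt0.
rewrite -(@lee_pmul2l _ c%:E) ?lte_fin //.
apply: le_trans H1 _.
rewrite muleCA muleC; apply: lee_wpmul2l => //.
rewrite -EFinM lee_fin exprMn -expRM_natr mulNr /c natrM (mulrA t) expRN.
rewrite [leRHS]mulrA divff ?gt_eqF ?expR_gt0 // mul1r.
by apply: ler_weXn2l => //; rewrite size_filter count_size.
Qed.

(** [L m] is meant to list sets of [m + 1] sites, so index [N] onwards means at least [N + 1]
    sites. *)
Definition heavy_union (L : nat -> seq (seq (site d))) (N : nat) : set Omega :=
  \bigcup_m \bigcup_(s in [set` L (N + m)%N]) heavy s.

Lemma measurable_heavy_union L N : measurable (heavy_union L N).
Proof.
apply: bigcupT_measurable => m; apply: fin_bigcup_measurable; first exact: finite_seq.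
by move=> s _; exact: measurable_heavy.
Qed.

Lemma nneseries_le (u : nat -> \bar R) (b : R) : (forall i, 0 <= u i)%E ->
  (forall n, (\sum_(0 <= i < n) u i)%E <= b%:E)%E -> (\sum_(0 <= i <oo) u i <= b%:E)%E.
Proof.
move=> u0 H; apply: lime_le; first by apply: is_cvg_nneseries => n _ _; exact: u0.
by near=> n; exact: H.
Unshelve. all: by end_near.
Qed.

Lemma heavy_union_bound L N I t g (C r : R) : uniq I ->
  (forall m s, s \in L m -> uniq s /\ size s = m.+1) ->
  0 <= t -> mgf P eta t = g%:E -> 0 < r < 1 -> 0 <= C ->
  (forall m, (size (L m))%:R * (expR (- (t * d%:R)) * g) ^+ m.+1 <= C * r ^+ m.+1) ->
  (P (cylinder I (fun=> 0%N) `&` heavy_union L N) <=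
   P (cylinder I (fun=> 0%N)) * (C / (1 - r) * r ^+ N.+1)%:E)%E.
Proof.
move=> uI LP t0 Eg /andP[r0 r1] C0 HC.
set Z := cylinder I _.
have mZ : measurable Z by exact: measurable_cylinder.
set q := expR _ * g in HC.
have [p p0 Ep] : exists2 p : R, 0 <= p & P Z = p%:E.
  exists (fine (P Z)); first exact: fine_ge0.
  by rewrite fineK ?fin_num_measure.
pose D m := \bigcup_(s in [set` L m]) heavy s.
have mD m : measurable (D m).
  by apply: fin_bigcup_measurable; [exact: finite_seq|move=> s _; exact: measurable_heavy].
have HD m : (P (Z `&` D m) <= (p * (C * r ^+ m.+1))%:E)%E.
  apply: (@le_trans _ _ ((size (L m))%:R * (p * q ^+ m.+1))%:E%E); last first.
    by rewrite lee_fin mulrCA; apply: ler_wpM2l.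
  have Ls s : s \in L m -> (P (Z `&` heavy s) <= (p * q ^+ m.+1)%:E)%E.
    move=> /LP[us <-]; have := chernoff_cylinder I s t g uI us t0 Eg.
    by rewrite -/Z Ep -EFinM.
  rewrite /D; elim: (L m) Ls => [|s l IH] Ls.
    by rewrite bigcup_seq big_nil setI0 measure0 mul0r.
  rewrite bigcup_seq big_cons -bigcup_seq setIUr.
  apply: le_trans (measureU2 _ _ _) _.
  - by apply: measurableI => //; exact: measurable_heavy.
  - apply: measurableI => //.
    by apply: fin_bigcup_measurable; [exact: finite_seq|move=> s' _; exact: measurable_heavy].
  rewrite /= mulrS mulrDl mul1r EFinD; apply: leeD.
    by apply: Ls; rewrite inE eqxx.
  by apply: IH => s' s'l; apply: Ls; rewrite inE s'l orbT.
rewrite /heavy_union setI_bigcupr.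
apply: le_trans (generalized_Boole_inequality _ _ _) _.
- by move=> m; apply: measurableI => //; exact: mD.
- by apply: bigcupT_measurable => m; apply: measurableI => //; exact: mD.
rewrite Ep -EFinM; apply: nneseries_le => // n.
apply: (@le_trans _ _ (\sum_(0 <= i < n) (p * (C * r ^+ (N + i).+1))%:E)%E).
  by apply: lee_sum => m _; exact: HD.
rewrite sumEFin lee_fin.
have := @geometric_le_lim R n (p * C * r ^+ N.+1) r.
rewrite /series /geometric /=.
have -> : \sum_(0 <= k < n) p * C * r ^+ N.+1 * r ^+ k = \sum_(0 <= i < n) p * (C * r ^+ (N + i).+1).
  by apply: eq_bigr => i _; rewrite -addSn exprD !mulrA.
move=> H; apply: le_trans (H _ _ _) _ => //.
- by rewrite !mulr_ge0 // exprn_ge0 // ltW.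
- by rewrite ger0_norm // ltW.
by rewrite -!mulrA [_^-1 * _]mulrC.
Qed.

End IID.

(** * Exponential tails *)
Section Tail.
Context {R : realType} {d0 : measure_display} {Omega : measurableType d0}
  (P : probability Omega R) {d : nat} (eta : Omega -> site d -> nat).
Hypothesis iid : iid_field P eta.

Lemma big_cluster_heavy L n :
  (forall A, animal d A -> exists2 s, s \in L (size A).-1 & perm_eq s A) ->
  (0 < n)%N -> big_cluster R eta n `<=` heavy_union eta L n.-1.
Proof.
move=> HL n0 w /(cluster_animal _ _ _ _ n0)[A [aA nA hA]].
have [s sL sA] := HL A aA.
exists ((size A).-1 - n.-1)%N => //.
have -> : (n.-1 + ((size A).-1 - n.-1))%N = (size A).-1 by lia.
by exists s => //; rewrite /heavy /= (perm_size sA) (perm_big _ sA).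
Qed.

(** Turns an inequality between functions on [nat] into one between expectations; simpler
    comparisons take zero for some coefficients. *)
Lemma expect_le (f h1 h2 : nat -> R) (a b c : R) :
  (forall k, 0 <= f k) -> (forall k, 0 <= h1 k) -> (forall k, 0 <= h2 k) ->
  0 <= a -> 0 <= b -> 0 <= c ->
  (forall k, f k <= a + b * h1 k + c * h2 k) ->
  (\int[P]_w (f (eta w 0%R))%:E <= a%:E + b%:E * \int[P]_w (h1 (eta w 0%R))%:E
     + c%:E * \int[P]_w (h2 (eta w 0%R))%:E)%E.
Proof.
move=> f0 h10 h20 a0 b0 c0 H.
have mE (h : nat -> R) : measurable_fun setT (fun w => (h (eta w 0%R))%:E).
  by apply/measurable_EFinP; exact: (measurable_site P eta iid _ _ h).
have m1 (b' : R) (h : nat -> R) : measurable_fun setT (fun w => b'%:E * (h (eta w 0%R))%:E)%E.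
  exact: (mE (fun k => b' * h k)).
rewrite -(ge0_integralZl_EFin _ _ _ (mE h1)) //; last by move=> w _; rewrite lee_fin.
rewrite -(ge0_integralZl_EFin _ _ _ (mE h2)) //; last by move=> w _; rewrite lee_fin.
rewrite -[a%:E]mule1 -(@probability_setT _ _ _ P) -integral_cst //.
rewrite -ge0_integralD //; first last.
- by move=> w _; rewrite -EFinM lee_fin mulr_ge0.
rewrite -ge0_integralD //; first last.
- by move=> w _; rewrite -EFinM lee_fin mulr_ge0.
- exact: (mE (fun k => a + b * h1 k)).
- by move=> w _; rewrite -EFinM -EFinD lee_fin addr_ge0 // mulr_ge0.
apply: ge0_le_integral => //.
- by move=> w _; rewrite lee_fin.
- exact: (mE (fun k => a + b * h1 k + c * h2 k)).
by move=> w _; rewrite -!EFinM -!EFinD lee_fin.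
Qed.

Lemma le_mgf (t u : R) : t <= u -> (mgf P eta t <= mgf P eta u)%E.
Proof.
move=> tu; have := expect_le (fun k => expR (t * k%:R)) (fun k => expR (u * k%:R))
  (fun=> 0) 0 1 0.
rewrite !(mul0e, mul1e, add0e, adde0); apply=> // k; rewrite ?expR_ge0 //.
by rewrite add0r mul1r mulr0 addr0 ler_expR ler_wpM2r.
Qed.

Lemma mgf_ge1 (t : R) : 0 <= t -> (1 <= mgf P eta t)%E.
Proof.
move=> t0; have := expect_le (fun=> 1) (fun k => expR (t * k%:R))
  (fun=> 0) 0 1 0.
have E1 : (\int[P]_w (1 : R)%:E = 1)%E.
  by rewrite integral_cst // mul1e; exact: probability_setT.
rewrite !(mul0e, mul1e, add0e, adde0) E1.
apply=> // k; rewrite ?expR_ge0 //.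
by rewrite add0r mul1r mulr0 addr0 -expR0 ler_expR mulr_ge0.
Qed.

Lemma mgf_fin (t : R) : 0 <= t -> (mgf P eta t < +oo)%E -> exists g, mgf P eta t = g%:E.
Proof.
by move=> /mgf_ge1; case: (mgf P eta t) => // g _ _; exists g.
Qed.

Lemma cylinder_nil (k : site d -> nat) : cylinder eta [::] k = setT :> set Omega.
Proof. by rewrite /cylinder bigcap_seq big_nil. Qed.

(* At [k = 0] the constant term suffices; for [k >= 1] this is AM-GM. *)
Lemma expR_le_rare (rho t : R) (k : nat) : 0 < rho ->
  expR (t * k%:R) <= 1 + rho / 2 * expR (2 * t * k%:R) + (2 * rho)^-1 * k%:R.
Proof.
move=> rho0; case: k => [|k].
  rewrite !mulr0 expR0 addr0 mulr1 lerDl; apply: divr_ge0 => //; exact: ltW.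
set y := expR _; have -> : expR (2 * t * k.+1%:R) = y * y.
  by rewrite -expRD; congr expR; ring.
have y0 : 0 < y by exact: expR_gt0.
have k1 : 1 <= k.+1%:R :> R by rewrite ler1n.
have i0 : 0 < (2 * rho)^-1 by rewrite invr_gt0 mulr_gt0.
have H : rho / 2 * (y * y) + (2 * rho)^-1 - y = (2 * rho)^-1 * (rho * y - 1) ^+ 2.
  by field; rewrite gt_eqF.
have : 0 <= (2 * rho)^-1 * (rho * y - 1) ^+ 2 by rewrite mulr_ge0 ?sqr_ge0 // ltW.
rewrite -H; have : (2 * rho)^-1 * 1 <= (2 * rho)^-1 * k.+1%:R by rewrite ler_wpM2l // ltW.
lra.
Qed.

(** Iterating [expR x <= 1 + x * expR x] leaves the remainder [x ^+ 2 * expR x]. As [x <= k] and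
    [k <= expR k], it is at most [t ^+ 2] times a cube of [expR k], whose mean is the generating
    function at [3]. *)
Lemma expR_le_taylor (t : R) (k : nat) : 0 <= t <= 1 ->
  expR (t * k%:R) <= 1 + t * k%:R + t ^+ 2 * expR (3 * k%:R).
Proof.
move=> /andP[t0 t1].
have k0 : 0 <= k%:R :> R by [].
set x := t * k%:R.
have x0 : 0 <= x by exact: mulr_ge0.
have e0 : 0 < expR x by exact: expR_gt0.
have H1 : expR x <= 1 + x * expR x.
  have := expR_ge1Dx (- x); rewrite expRN -(ler_pM2r e0) mulVf ?gt_eqF //; lra.
have kE : k%:R <= expR k%:R :> R by have := expR_ge1Dx (k%:R : R); lra.
have xE : expR x <= expR k%:R by rewrite ler_expR /x ler_piMl.
have -> : expR (3 * k%:R) = expR k%:R * expR k%:R * expR k%:R :> R.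
  by rewrite -!expRD; congr expR; ring.
have H2 : k%:R * k%:R * expR x <= expR k%:R * expR k%:R * expR k%:R :> R.
  by rewrite !ler_pM ?mulr_ge0 ?expR_ge0.
have H3 : x * expR x <= x * (1 + x * expR x) by rewrite ler_wpM2l.
have H4 : t ^+ 2 * (k%:R * k%:R * expR x) <= t ^+ 2 * (expR k%:R * expR k%:R * expR k%:R).
  by rewrite ler_wpM2l // sqr_ge0.
have H5 : x * (x * expR x) = t ^+ 2 * (k%:R * k%:R * expR x) by rewrite /x; ring.
lra.
Qed.

(** The coefficients in [expR_le_rare] are balanced so that the three terms contribute [1], [1/2]
    and [1/2]. *)
Lemma mgf_le2 (rho t x : R) : 0 < rho -> 0 <= t -> density P eta = rho%:E ->
  2 * t <= x -> (mgf P eta x <= (rho^-1)%:E)%E -> (mgf P eta t <= 2%:E)%E.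
Proof.
move=> rho0 t0 Erho tx mx.
apply: le_trans (expect_le (fun k => expR (t * k%:R)) (fun k => expR (2 * t * k%:R))
  (fun k => k%:R) 1 (rho / 2) (2 * rho)^-1 _ _ _ _ _ _ _) _ => //.
- by apply: divr_ge0 => //; exact: ltW.
- by rewrite invr_ge0 mulr_ge0 // ltW.
- by move=> k; exact: expR_le_rare.
rewrite -/(density P eta) -/(mgf P eta _) Erho -EFinM.
apply: (@le_trans _ _ (1%:E + (rho / 2)%:E * (rho^-1)%:E + ((2 * rho)^-1 * rho)%:E)%E).
  rewrite leeD2r // leeD2l // lee_wpmul2l //.
    by rewrite lee_fin divr_ge0 // ltW.
  exact: le_trans (le_mgf _ _ tx) mx.
rewrite -EFinM -!EFinD lee_fin le_eqVlt; apply/orP; left; apply/eqP.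
by field; rewrite gt_eqF.
Qed.

Lemma prob_le_big_cluster0 (c : R) : prob_le P (big_cluster R eta 0) (expR (- (c * 0%:R))).
Proof.
by exists setT; split => //; split => //; rewrite mulr0 oppr0 expR0; exact: probability_le1.
Qed.

(** With [t = 32 d] one has [g <= 2] and [expR (t * d) >= 32 d ^ 2], so the count [(2 d) ^ 2] per
    site times the Chernoff factor is at most [1/4]. Summing gives [4/3] times a power of [1/4], and
    half the rate absorbs the [4/3]. *)
Lemma tail_high_dim (rho : R) : (0 < d)%N -> 0 < rho -> density P eta = rho%:E ->
  (exists2 x, 64 * d%:R <= x & (mgf P eta x <= (rho^-1)%:E)%E) ->
  forall n, prob_le P (big_cluster R eta n) (expR (- (ln 2 * n%:R))).
Proof.
move=> dpos rho0 Erho [x dx mx] [|n]; first exact: prob_le_big_cluster0.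
have D1 : 1 <= d%:R :> R by rewrite ler1n.
pose t := 32 * d%:R : R.
have t0 : 0 <= t by rewrite mulr_ge0.
have g2 : (mgf P eta t <= 2%:E)%E.
  by apply: (mgf_le2 rho _ x) => //; rewrite /t; lra.
have g1 := mgf_ge1 t t0.
have [g Eg] := mgf_fin t t0 (le_lt_trans g2 (ltry _)).
rewrite Eg !lee_fin in g1 g2.
exists (heavy_union eta (walk_sets d) n); split; first exact: (measurable_heavy_union P eta iid).
split; first by apply: (big_cluster_heavy _ n.+1) => // A aA; exact: animal_walk_sets.
have := heavy_union_bound P eta iid (walk_sets d) n [::] t g 1 4^-1.
rewrite cylinder_nil setTI probability_setT mul1e => H.
apply: le_trans (H _ _ _ _ _ _ _) _ => //.
- exact: walk_sets_uniq.
- by lra.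
- move=> m; set q := expR _ * g.
  have q0 : 0 <= q by rewrite mulr_ge0 ?expR_ge0 //; lra.
  have qd : (2 * d%:R) ^+ 2 * q <= 4^-1.
    have E : 32 * d%:R * d%:R <= expR (t * d%:R) by have := expR_ge1Dx (t * d%:R); rewrite /t; lra.
    have e0 : 0 < expR (t * d%:R) by exact: expR_gt0.
    rewrite /q expRN mulrCA ler_pdivrMl // .
    have : 4 * (d%:R * d%:R) * g <= 4 * (d%:R * d%:R) * 2 :> R.
      by rewrite ler_wpM2l // !mulr_ge0.
    rewrite expr2; lra.
  rewrite mul1r; apply: (@le_trans _ _ (((2 * d%:R) ^+ 2 * q) ^+ m.+1)); last first.
    by apply: lerXn2r => //; rewrite nnegrE ?mulr_ge0 // ?sqr_ge0 //; lra.
  rewrite [leRHS]exprMn ler_wpM2r ?exprn_ge0 // -exprM.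
  apply: (@le_trans _ _ ((2 * d%:R) ^+ m.*2)).
    by rewrite -natrM -natrX ler_nat size_walk_sets.
  apply: ler_weXn2l; first by rewrite -natrM ler1n muln_gt0.
  by rewrite -mul2n leq_mul2l leqnSn orbT.
have -> : expR (- (ln 2 * n.+1%:R)) = 2^-1 ^+ n.+1 :> R.
  by rewrite -mulNr expRM_natr expRN lnK // posrE.
have -> : 4^-1 = 2^-1 * 2^-1 :> R by lra.
rewrite lee_fin exprMn mulrA -[leRHS]mul1r ler_wpM2r ?exprn_ge0 //.
have : 2^-1 ^+ n <= 1 :> R by rewrite exprn_ile1 //; lra.
have -> : 1 / (1 - 2^-1 * 2^-1) = 4 / 3 :> R by field.
rewrite exprS; lra.
Qed.


Lemma nat_large (x a : R) : 0 < a -> exists N : nat, forall n, (N <= n)%N -> x <= expR (a * n%:R).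
Proof.
move=> a0; exists (Num.bound `|x / a|) => n Nn.
have xn : x / a < n%:R.
  apply: (@lt_le_trans _ _ (Num.bound `|x / a|)%:R); last by rewrite ler_nat.
  by apply: le_lt_trans (ler_norm _) _; exact: archi_boundP.
rewrite ltr_pdivrMr // mulrC in xn.
have := expR_ge1Dx (a * n%:R); lra.
Qed.

(** For [n >= N] half of the rate [a] absorbs the prefactor [K]. The finitely many smaller [n] are
    covered by [p < 1], with the rate small enough that [expR (- (c * n))] stays above [p]. *)
Lemma exp_decay_of_tail (B : nat -> set Omega) (K a p : R) :
  0 < a -> 0 < p < 1 ->
  (forall n, (P (B n) <= (K * expR (- (a * n%:R)))%:E)%E) ->
  (forall n, (P (B n) <= p%:E)%E) ->
  exists2 c : R, 0 < c & forall n, (P (B n) <= (expR (- (c * n%:R)))%:E)%E.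
Proof.
move=> a0 /andP[p0 p1] HK Hp.
have a2 : 0 < a / 2 by rewrite divr_gt0.
have [N HN] := nat_large K (a / 2) a2.
have lp : 0 < - ln p by rewrite oppr_gt0 ln_lt0 // p0.
exists (Num.min (a / 2) (- ln p / N.+1%:R)).
  by rewrite lt_min a2 divr_gt0.
move=> n; have [Nn|nN] := leqP N n.
  apply: le_trans (HK n) _; rewrite lee_fin.
  apply: (@le_trans _ _ (expR (a / 2 * n%:R) * expR (- (a * n%:R)))).
    by rewrite ler_wpM2r ?expR_ge0 // HN.
  rewrite -expRD ler_expR.
  have : Num.min (a / 2) (- ln p / N.+1%:R) * n%:R <= a / 2 * n%:R.
    by rewrite ler_wpM2r // ge_min lexx.
  lra.
apply: le_trans (Hp n) _; rewrite lee_fin -[leLHS]lnK ?posrE // ler_expR lerNr.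
apply: (@le_trans _ _ (- ln p / N.+1%:R * n%:R)).
  by rewrite ler_wpM2r // ge_min lexx orbT.
rewrite mulrAC ler_pdivrMr // ler_wpM2l ?(ltW lp) // ler_nat; lia.
Qed.

(** Otherwise [eta] would be at least [1] almost surely; integrate [1 <= k + (k == 0)]. *)
Lemma prob_site0_gt0 : (density P eta < 1%:E)%E -> (0 < P [set w | eta w 0%R = 0%N])%E.
Proof.
move=> rho1; rewrite lt0e measure_ge0 andbT; apply/eqP => p0.
have := expect_le (fun=> 1) (fun k => k%:R) (fun k => (k == 0%N)%:R) 0 1 1.
have -> : (\int[P]_w ((eta w 0%R == 0%N)%:R : R)%:E = 0)%E.
  rewrite -p0 -[in RHS](setIT [set w | _]) -integral_indic //; last exact: iid.1.
  apply: eq_integral => w _; rewrite indicE; congr (_%:R)%:E.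
  by congr nat_of_bool; apply/eqP/idP; rewrite inE.
have -> : (\int[P]_w (1 : R)%:E = 1)%E.
  by rewrite integral_cst // mul1e; exact: probability_setT.
rewrite !mul1e adde0 add0e => H.
have : (1 <= density P eta)%E.
  by apply: H => // -[|k]; rewrite !mul1r !add0r //= addr0 ler1n.
by rewrite leNgt rho1.
Qed.

End Tail.

Lemma prob_cylinder_gt0 {R : realType} {d0 : measure_display} {Omega : measurableType d0}
  (P : probability Omega R) {d : nat} (eta : Omega -> site d -> nat) (s : seq (site d)) :
  iid_field P eta -> uniq s -> (0 < P [set w | eta w 0%R = 0%N])%E ->
  (0 < P (cylinder eta s (fun=> 0%N)))%E.
Proof.
move=> iid us p0; elim: s us => [|x s IH] us.
  by rewrite cylinder_nil probability_setT.
rewrite prob_cylinder_cons //; apply: mule_gt0 => //; apply: IH.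
by case/andP: us.
Qed.

Lemma tail_dim1 {R : realType} {d0 : measure_display} {Omega : measurableType d0}
  (P : probability Omega R) (eta : Omega -> site 1 -> nat) (t g : R) :
  iid_field P eta -> (0 < P [set w | eta w 0%R = 0%N])%E ->
  0 <= t -> mgf P eta t = g%:E -> expR (- t) * g < 1 ->
  exists c : R, 0 < c /\
       forall n : nat, prob_le P (big_cluster R eta n) (expR (- (c * n%:R))).
Proof.
move=> iid p0 t0 Eg q1.
have g1 : 1 <= g by rewrite -lee_fin -Eg mgf_ge1.
set q := expR (- t) * g in q1.
have q0 : 0 < q by rewrite mulr_gt0 ?expR_gt0 //; lra.
(* Writing [q = r * r] lets one factor [r] absorb the number of intervals and keeps the other as
   decay. *)
pose a := - ln q / 2.
have a0 : 0 < a by rewrite divr_gt0 // oppr_gt0 ln_lt0 // q0.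
have qE : q = expR (- a) * expR (- a).
  by rewrite -expRD -[LHS]lnK //; congr expR; rewrite /a; lra.
set r := expR (- a) in qE.
have r0 : 0 < r by exact: expR_gt0.
have r1 : r < 1 by rewrite /r -expR0 ltr_expR; lra.
have rX k : r ^+ k = expR (- (a * k%:R)) by rewrite -mulNr expRM_natr.
have HL m : (size (zintervals m))%:R * q ^+ m.+1 <= a^-1 * r ^+ m.+1.
  rewrite size_map size_iota qE exprMn mulrA ler_wpM2r ?exprn_ge0 ?(ltW r0) //.
  rewrite rX expRN ler_pdivrMr ?expR_gt0 // ler_pdivlMl //.
  by have := expR_ge1Dx (a * m.+1%:R); lra.
have HU N I : uniq I -> (P (cylinder eta I (fun=> 0%N) `&` heavy_union eta zintervals N) <=
    P (cylinder eta I (fun=> 0%N)) * (a^-1 / (1 - r) * r ^+ N.+1)%:E)%E.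
  move=> uI; apply: (heavy_union_bound P eta iid _ _ _ t g) => //.
  - exact: zintervals_uniq.
  - by rewrite r0.
  - by rewrite invr_ge0 ltW.
  - by move=> m; rewrite mulr1.
set K := a^-1 / (1 - r) in HU.
(* This [N] makes [K * r ^+ N.+1] at most [1/2]. *)
have [N HN] := nat_large (2 * K) a a0.
pose I := zinterval N N.
pose Z := cylinder eta I (fun=> 0%N).
have mZ : measurable Z by exact: (measurable_cylinder P eta iid).
have mH n : measurable (heavy_union eta zintervals n) by exact: (measurable_heavy_union P eta iid).
have Z0 : (0 < P Z)%E by apply: prob_cylinder_gt0 => //; exact: zinterval_uniq.
(* When [[-N, N]] is empty, intervals of index at most [N] lie inside it and carry no grain, so only
   longer ones can be heavy. *)
have ZH : Z `&` heavy_union eta zintervals 0 `<=` Z `&` heavy_union eta zintervals N.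
  move=> w [Zw [m _ [s sL hs]]]; split => //.
  have [mN|Nm] := leqP m N; last by exists (m - N)%N => //; exists s => //=; rewrite subnKC // ltnW.
  exfalso; move: hs; rewrite /heavy /= big1_seq; last first.
    by move=> x /andP[_ xs]; apply: Zw; exact: (zintervals_sub _ _ _ mN sL).
  by have [_ ->] := zintervals_uniq _ _ sL.
have [z zE] : exists z : R, P Z = z%:E.
  by exists (fine (P Z)); rewrite fineK ?fin_num_measure.
have z1 : z <= 1 by rewrite -lee_fin -zE probability_le1.
rewrite zE lte_fin in Z0.
have HZ : (P (Z `&` heavy_union eta zintervals 0) <= (z / 2)%:E)%E.
  apply: le_trans (le_measure P _ _ ZH) _; rewrite ?inE; do ?exact: measurableI.
  apply: le_trans (HU N I (zinterval_uniq _ _)) _; rewrite -/Z zE -EFinM lee_fin ler_wpM2l ?(ltW Z0) //.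
  rewrite rX expRN ler_pdivrMr ?expR_gt0 // ler_pdivlMl //.
  exact: HN.
(* Outside [Z] the event is given up entirely; inside, half of [Z] is saved. *)
have Hp : (P (heavy_union eta zintervals 0) <= (1 - z / 2)%:E)%E.
  apply: (@le_trans _ _ (P (~` Z `|` (Z `&` heavy_union eta zintervals 0)))).
    apply: le_measure; rewrite ?inE //.
      by apply: measurableU; [exact: measurableC|exact: measurableI].
    by move=> w Hw; have [Zw|Zw] := pselect (Z w); [right|left].
  apply: le_trans (measureU2 _ _ _) _; [exact: measurableC|exact: measurableI|].
  rewrite [X in (X + _)%E]probability_setC // zE.
  apply: (@le_trans _ _ ((1 - z)%:E + (z / 2)%:E)%E); first by rewrite leeD2l.
  by rewrite -EFinD lee_fin; lra.
have K0 : 0 <= K by rewrite divr_ge0 ?invr_ge0 ?subr_ge0 ?ltW.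
have [||n|c c0 Hc] := exp_decay_of_tail P (fun n => heavy_union eta zintervals n.-1)
   K a (1 - z / 2) a0.
- by apply/andP; split; lra.
- move=> n; have := HU n.-1 [::] isT.
  rewrite cylinder_nil setTI probability_setT mul1e => /le_trans; apply.
  rewrite lee_fin -rX ler_wpM2l //.
  by apply: ler_wiXn2l; [exact: ltW|exact: ltW|exact: leqSpred].
- apply: le_trans (le_measure P _ _ _) Hp; rewrite ?inE //.
  by move=> w [m _ H]; exists (n.-1 + m)%N.
exists c; split => // -[|n]; first exact: prob_le_big_cluster0.
exists (heavy_union eta zintervals n); split => //; split; last exact: (Hc n.+1).
apply: (big_cluster_heavy eta _ n.+1) => // A aA; exact: animal_zintervals.
Qed.

Lemma mgf_small_time {R : realType} {d0 : measure_display} {Omega : measurableType d0}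
  (P : probability Omega R) {d : nat} (eta : Omega -> site d -> nat) :
  iid_field P eta -> (forall t : R, (mgf P eta t < +oo)%E) ->
  (density P eta < 1%:E)%E ->
  exists t g : R, [/\ 0 <= t, mgf P eta t = g%:E & expR (- t) * g < 1].
Proof.
move=> iid mfin rho1.
have [rho rho0 Erho] : exists2 rho : R, 0 <= rho & density P eta = rho%:E.
  have : (0 <= density P eta)%E by apply: integral_ge0 => w _; rewrite lee_fin.
  by case: (density P eta) rho1 => // rho _ rho0; exists rho.
have [M EM] := mgf_fin P eta iid 3 (ler0n _ 3) (mfin 3).
have M1 : 1 <= M by rewrite -lee_fin -EM mgf_ge1.
rewrite Erho lte_fin in rho1.
(* Chosen so that [rho + t * M = 1 - t]. The Taylor bound then reads [g <= 1 + t * (1 - t)], below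
   [1 + t <= expR t]. *)
pose t := (1 - rho) / (M + 1).
have M1' : 0 < M + 1 by lra.
have tM : t * (M + 1) = 1 - rho by rewrite /t divfK // gt_eqF.
have t0 : 0 < t by rewrite divr_gt0 //; lra.
have t1 : t <= 1 by rewrite ler_pdivrMr //; lra.
have [g Eg] := mgf_fin P eta iid t (ltW t0) (mfin t).
exists t, g; split => //; first exact: ltW.
have : g <= 1 + t * rho + t ^+ 2 * M.
  rewrite -lee_fin -Eg.
  apply: le_trans (expect_le P eta iid (fun k => expR (t * k%:R)) (fun k => k%:R)
    (fun k => expR (3 * k%:R)) 1 t (t ^+ 2) _ _ _ _ _ _ _) _ => //.
  - exact: ltW.
  - exact: sqr_ge0.
  - by move=> k; apply: expR_le_taylor; rewrite ltW.
  by rewrite -/(density P eta) -/(mgf P eta 3) Erho EM -!EFinM -!EFinD.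
rewrite expRN ltr_pdivrMl ?expR_gt0 // mulr1 => gle.
have := expR_ge1Dx t.
have : t * rho + t ^+ 2 * M < t.
  have -> : t * rho + t ^+ 2 * M = t * (rho + t * M) by ring.
  by rewrite gtr_pMr //; lra.
lra.
Qed.

Lemma pos_of_near_right0 {R : realType} (Q : R -> Prop) :
  (\forall x \near 0^'+, Q x) -> exists2 e, 0 < e & forall x, 0 < x < e -> Q x.
Proof.
move=> [e /= e0 He]; exists e => // x /andP[x0 xe]; apply: He => //=.
by rewrite sub0r normrN gtr0_norm.
Qed.

Theorem theorem4p2 (R : realType) :
  (* (a) d = 1 *)
  (forall (d0 : measure_display) (Omega : measurableType d0)
          (P : probability Omega R) (eta : Omega -> site 1 -> nat),
     iid_field P eta ->
     (forall t : R, (mgf P eta t < +oo)%E) ->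
     (density P eta < 1%:E)%E ->
     exists c1 : R, 0 < c1 /\
       forall n : nat, prob_le P (big_cluster R eta n) (expR (- (c1 * n%:R)))) /\
  (* (b) d > 1 *)
  (forall (d : nat) (d0 : measure_display) (Omega : measurableType d0)
          (P : R -> probability Omega R) (eta : Omega -> site d -> nat),
     (1 < d)%N ->
     (forall rho, 0 < rho < 1 -> iid_field (P rho) eta) ->
     (forall rho, 0 < rho < 1 -> forall t : R, (mgf (P rho) eta t < +oo)%E) ->
     (forall rho, 0 < rho < 1 -> density (P rho) eta = rho%:E) ->
     (forall a : R -> R,
        (forall rho, 0 < rho < 1 -> 0 <= a rho) ->
        a x @[x --> 0^'+] --> +oo ->
        ereal_sup [set x%:E | x in [set x : R | (mgf (P rho) eta x <= (a rho)%:E)%E]]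
          @[rho --> 0^'+] --> +oo%E) ->
     exists rho0 : R, 0 < rho0 /\
       forall rho, 0 < rho < rho0 -> rho < 1 ->
         exists cd : R, 0 < cd /\
           forall n : nat,
             prob_le (P rho) (big_cluster R eta n) (expR (- (cd * n%:R)))).
Proof.
split.
  move=> d0 Omega P eta iid mfin rho1.
  have [t [g [t0 Eg q1]]] := mgf_small_time P eta iid mfin rho1.
  exact: (tail_dim1 P eta t g iid (prob_site0_gt0 P eta iid rho1) t0 Eg q1).
move=> d d0 Omega P eta d1 iid _ Erho Hsup.
have inv_cvg : x^-1 @[x --> (0 : R)^'+] --> +oo.
  apply/cvgrVy; first exact: nbhs_right_gt.
  by apply: cvg_at_right_filter; exact: cvg_id.
have inv_ge0 (rho : R) : 0 < rho < 1 -> 0 <= rho^-1.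
  by move=> /andP[rho0 _]; rewrite invr_ge0 ltW.
(* The level [64 d] is twice the time [32 d] used in [tail_high_dim]. *)
have [e e0 He] := pos_of_near_right0 _ (cvgey_gt (Hsup GRing.inv inv_ge0 inv_cvg) (64 * d%:R)).
exists e; split => // rho rhoe rho1.
have rho01 : 0 < rho < 1 by rewrite rho1 andbT; case/andP: rhoe.
(* The same rate [ln 2] serves every small [rho]. *)
exists (ln 2); split; first by rewrite ln_gt0 // ltr1n.
apply: (tail_high_dim (P rho) eta (iid _ rho01) rho) => //.
- exact: ltnW.
- by case/andP: rho01.
- exact: Erho.
have /ereal_sup_gt[_ [x mx <-] dx] := He _ rhoe.
by exists x => //; rewrite -lee_fin ltW.
Qed.
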